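(* Let $p$ and $q$ be distributions on $[k]$, let $\ell\in\mathbb N$ and $\epsilon\geq 0$. Let $\mathcal C$ be the set of $\epsilon$-LDP channels from $[k]$ to $[\ell]$. Let $\mathcal A$ be the set of all pairs of distributions that are obtained by applying a channel from $\mathcal C$ to $p$ and $q$, i.e., $$\mathcal A=\{(\mathbf Tp,\mathbf Tq)\mid\mathbf T\in\mathcal C\}.$$ If $(\mathbf Tp,\mathbf Tq)$ is an extreme point of $\mathcal A$ for $\mathbf T\in\mathcal C$, then $\mathbf T$ can be written as $\mathbf T=\mathbf T_2\times\mathbf T_1$ for some threshold channel $\mathbf T_1\in\mathcal T_{2\ell^2,k}$ and some $\mathbf T_2$ an extreme point of the set of $\epsilon$-LDP channels from $[2\ell^2]$ to $[\ell]$.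
   Context: $[k]=\{1,\dots,k\}$. $\mathcal T_{\ell,k}$ is the set of all channels from $[k]$ to $[\ell]$, i.e. column-stochastic $\ell\times k$ matrices $\mathbf T$; $\mathbf Tp$ is the matrix-vector product and $\mathbf T_2\times\mathbf T_1$ the matrix product. $\mathbf T$ is $\epsilon$-LDP if $\mathbf T(y,x)\le e^\epsilon\,\mathbf T(y,x')$ for all inputs $x,x'$ and outputs $y$. Threshold channel (with respect to $p,q$): a deterministic channel $\mathbf T\in\mathcal T_{\ell,k}$ (viewed as a map $[k]\to[\ell]$) such that for every $u,v\in[k]$: if $\frac{p(u)}{q(u)}<\frac{p(v)}{q(v)}$ and $\mathbf T(u)=\mathbf T(v)$, then any $w\in[k]$ with $\frac{p(w)}{q(w)}\in\left(\frac{p(u)}{q(u)},\frac{p(v)}{q(v)}\right)$ satisfies $\mathbf T(w)=\mathbf T(u)=\mathbf T(v)$. The likelihood ratios $p(i)/q(i)$ are assumed to take values in the extended real line (equal to $+\infty$ if $q(i)=0\ne p(i)$; thus no $i$ has $p(i)=q(i)=0$). *)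

(* Defs.v *)
From HB Require Import structures.
From mathcomp Require Import all_boot all_order all_algebra.
From mathcomp Require Import boolp classical_sets reals constructive_ereal.
From mathcomp Require Import sequences exp.

Set Implicit Arguments.
Unset Strict Implicit.
Unset Printing Implicit Defensive.

Import Order.TTheory GRing.Theory Num.Theory.

Local Open Scope classical_set_scope.
Local Open Scope ring_scope.

Definition is_distr (R : numDomainType) (k : nat) (p : 'cV[R]_k) : Prop :=
  (forall i, 0 <= p i 0) /\ \sum_i p i 0 = 1.

(* [T y x] is the probability of output [y] on input [x]. *)
Definition is_channel (R : numDomainType) (l k : nat) (T : 'M[R]_(l, k)) :
  Prop := forall x, is_distr (col x T).

Definition LDP_channels (R : realType) (eps : R) (l k : nat) :
    set 'M[R]_(l, k) :=
  [set T | is_channel T /\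
           forall (y : 'I_l) (x x' : 'I_k), T y x <= expR eps * T y x'].

Arguments LDP_channels {R} eps l k.

Definition extreme_point (R : numDomainType) (E : lmodType R) (A : set E)
    (x : E) : Prop :=
  A x /\
  forall (y z : E) (t : R), A y -> A z -> 0 < t < 1 ->
    x = t *: y + (1 - t) *: z -> y = x /\ z = x.

(* Only meaningful when [p i] and [q i] are not both zero. *)
Definition likelihood_ratio (R : realType) (k : nat) (p q : 'cV[R]_k)
    (i : 'I_k) : \bar R :=
  if q i 0 == 0 then +oo%E else (p i 0 / q i 0)%:E.

Definition det_channel (R : numDomainType) (l k : nat) (f : 'I_k -> 'I_l) :
  'M[R]_(l, k) := \matrix_(y, x) (y == f x)%:R.

(* The map [f] is determined by the matrix [T]. *)
Definition threshold_channel (R : realType) (l k : nat) (p q : 'cV[R]_k)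
    (T : 'M[R]_(l, k)) : Prop :=
  exists f : 'I_k -> 'I_l, T = det_channel R f /\
    forall u v : 'I_k,
      (likelihood_ratio p q u < likelihood_ratio p q v)%E -> f u = f v ->
      forall w : 'I_k,
        (likelihood_ratio p q u < likelihood_ratio p q w)%E ->
        (likelihood_ratio p q w < likelihood_ratio p q v)%E ->
        f w = f u /\ f w = f v.

Definition LDP_output_pairs (R : realType) (eps : R) (l k : nat)
    (p q : 'cV[R]_k) : set ('cV[R]_l * 'cV[R]_l) :=
  [set (T *m p, T *m q) | T in LDP_channels eps l k].

Arguments LDP_output_pairs {R} eps l {k} p q.

(* Main.v *)
(* Perturb T inside the set of LDP channels: by extremality, a
   perturbation E with T + E and T - E both feasible satisfies E p = E q = 0.

   Call an entry of T free if none of the constraints T(y,x) <= e^eps T(y,x')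
   involving it is tight. Exchanging mass between two free entries of a column
   is a feasible perturbation which is not killed by both p and q, so each
   column has at most one free entry, while the non-free entries of a row can
   only be rescaled together. An l1-counting argument then shows that T admits
   no feasible perturbation at all, hence is an extreme channel, and so is any
   channel with the same columns.

   For rows y != y', say that x can be exchanged if T(y,x) is not the maximum
   of row y and T(y',x) is not the minimum of row y'. If u, v, w are sorted by
   likelihood ratio, one cannot exchange (y,y') at v and (y',y) at both u and
   w. So if level x counts the pairs (y,y') for which (y',y) can be exchanged
   at some v with ratio at most that of x, inputs with the same level have the
   same column of T; level is monotone in the ratio and takes at most
   l^2 + 1 <= 2 l^2 values. It is the threshold channel T1. *)

Require Import Defs.
From HB Require Import structures.
From mathcomp Require Import all_boot all_order all_algebra.
From mathcomp Require Import boolp classical_sets reals constructive_ereal.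
From mathcomp Require Import sequences exp.
From mathcomp Require Import ring lra.

Set Implicit Arguments.
Unset Strict Implicit.
Unset Printing Implicit Defensive.

Import Order.TTheory GRing.Theory Num.Theory.

Local Open Scope classical_set_scope.
Local Open Scope ring_scope.

(** * Linear constraints and small steps *)

Lemma LDP_channelsP (R : realType) (eps : R) (l k : nat) (T : 'M[R]_(l, k)) :
  LDP_channels eps l k T <->
  [/\ forall y x, 0 <= T y x, forall x, \sum_y T y x = 1 &
      forall y x x', T y x <= expR eps * T y x'].
Proof.
split=> [[chT ldpT]|[T0 T1 ldpT]].
  split=> // [y x|x]; first by have [/(_ y)] := chT x; rewrite mxE.
  by have [_ <-] := chT x; apply: eq_bigr => y _; rewrite mxE.
split=> // x; split=> [y|]; first by rewrite mxE.
by rewrite -(T1 x); apply: eq_bigr => y _; rewrite mxE.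
Qed.

(** Positive coordinates tolerate a small step in any direction; by finiteness one step length suits
    them all. *)
Lemma small_step_ge0 (R : realFieldType) (I : finType) (a b : I -> R) :
  (forall i, 0 <= a i) -> (forall i, a i = 0 -> 0 <= b i) ->
  exists2 d, 0 < d & forall i, 0 <= a i + d * b i.
Proof.
move=> a0 b0.
have step i : exists2 d, 0 < d & forall d', 0 < d' <= d -> 0 <= a i + d' * b i.
  have [ai0|ai_neq0] := eqVneq (a i) 0.
    exists 1 => // d' /andP[/ltW d'0 _].
    by rewrite ai0 add0r mulr_ge0 ?b0.
  have ai_gt0 : 0 < a i by rewrite lt0r ai_neq0 a0.
  have den : 0 < 1 + `|b i| by rewrite ltr_pwDl.
  exists (a i / (1 + `|b i|)); first by rewrite divr_gt0.
  move=> d' /andP[d'0]; rewrite ler_pdivlMr // => d'le.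
  have : - `|b i| <= b i by rewrite lerNl -normrN ler_norm.
  move/(ler_wpM2l (ltW d'0)) => h; move: d'le h; nra.
suff [d d0 dP] : exists2 d, 0 < d &
    forall i, i \in enum I -> forall d', 0 < d' <= d -> 0 <= a i + d' * b i.
  by exists d => // i; apply: dP; rewrite ?mem_enum // d0 lexx.
elim: (enum I) => [|i s [d d0 dP]]; first by exists 1.
have [d1 d10 d1P] := step i.
exists (Num.min d1 d); first by rewrite lt_min d10.
move=> j; rewrite inE => /predU1P[->|js] d' /andP[d'0];
  rewrite le_min => /andP[le1 le2].
  by apply: d1P; rewrite d'0.
by apply: dP; rewrite ?d'0.
Qed.

Lemma sumr_indicator (R : pzSemiRingType) (I : finType) (j : I) (F : I -> R) :
  \sum_i (i == j)%:R * F i = F j.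
Proof.
rewrite (bigD1 j) //= eqxx mul1r big1 ?addr0 // => i /negPf ->.
by rewrite mul0r.
Qed.

(** * Likelihood ratios as slopes of planar vectors *)

Section LikelihoodRatio.
Context (R : realType) (k : nat) (p q : 'cV[R]_k).
Context (p_ge0 : forall i, 0 <= p i 0) (q_ge0 : forall i, 0 <= q i 0).
Context (pq_neq0 : forall i : 'I_k, ~ (p i 0 = 0 /\ q i 0 = 0)).

Lemma likelihood_ratio_le_cross (i j : 'I_k) :
  (likelihood_ratio p q i <= likelihood_ratio p q j)%E ->
  p i 0 * q j 0 <= p j 0 * q i 0.
Proof.
rewrite /likelihood_ratio.
have [->|qj] := eqVneq (q j 0) 0; first by rewrite mulr0 mulr_ge0.
have [qi|qi] := eqVneq (q i 0) 0; first by rewrite leye_eq.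
rewrite lee_fin ler_pdivrMr ?lt0r ?qi ?q_ge0 //.
by rewrite mulrAC ler_pdivlMr ?lt0r ?qj ?q_ge0.
Qed.

(* Cramer's rule, except when all three vectors are parallel. *)
Lemma likelihood_ratio_between (u v w : 'I_k) :
  (likelihood_ratio p q u <= likelihood_ratio p q v)%E ->
  (likelihood_ratio p q v <= likelihood_ratio p q w)%E ->
  exists d a b : R, [/\ 0 < d, 0 <= a, 0 <= b,
    d * p v 0 = a * p u 0 + b * p w 0 & d * q v 0 = a * q u 0 + b * q w 0].
Proof.
move=> ratio_uv ratio_vw.
have uv := likelihood_ratio_le_cross ratio_uv.
have vw := likelihood_ratio_le_cross ratio_vw.
have := likelihood_ratio_le_cross (le_trans ratio_uv ratio_vw).
rewrite le_eqVlt => /predU1P[uw0|uw].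
  have pos i : 0 < p i 0 + q i 0.
    rewrite lt0r addr_ge0 // andbT paddr_eq0 //.
    by apply/negP => /andP[/eqP pi /eqP qi]; apply: (@pq_neq0 i).
  (* [A] times the vector of [w] plus [B] times that of [u] is a determinant times that of [v], here
     zero. As [A] and [B] are nonnegative and the vector of [w] is nonzero, [A] vanishes. *)
  have {}uv : p v 0 * q u 0 = p u 0 * q v 0.
    have pw := pos w.
    set A := p v 0 * q u 0 - p u 0 * q v 0.
    set B := p w 0 * q v 0 - p v 0 * q w 0.
    have A0 : 0 <= A by rewrite subr_ge0.
    have B0 : 0 <= B by rewrite subr_ge0.
    have eqp : A * p w 0 + B * p u 0 = 0.
      transitivity (p v 0 * (p w 0 * q u 0 - p u 0 * q w 0)).
        by rewrite /A /B; ring.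
      by rewrite uw0 subrr mulr0.
    have eqq : A * q w 0 + B * q u 0 = 0.
      transitivity (q v 0 * (p w 0 * q u 0 - p u 0 * q w 0)).
        by rewrite /A /B; ring.
      by rewrite uw0 subrr mulr0.
    apply/eqP; rewrite -subr_eq0 -/A.
    have : A * (p w 0 + q w 0) + B * (p u 0 + q u 0) = 0.
      by rewrite !mulrDr addrACA eqp eqq addr0.
    move/eqP; rewrite paddr_eq0 ?mulr_ge0 ?(ltW (pos _)) //.
    by rewrite mulf_eq0 (gt_eqF pw) orbF => /andP[].
  exists (p u 0 + q u 0); exists (p v 0 + q v 0); exists 0; split=> //.
  - by rewrite addr_ge0.
  - lra.
  - lra.
exists (p w 0 * q u 0 - p u 0 * q w 0), (p w 0 * q v 0 - p v 0 * q w 0),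
  (p v 0 * q u 0 - p u 0 * q v 0); rewrite !subr_ge0 subr_gt0.
by split=> //; ring.
Qed.

End LikelihoodRatio.

(** * Feasible directions at an extreme output pair *)

Section ExtremeOutputPairs.
Context (R : realType) (k l : nat) (p q : 'cV[R]_k) (eps : R).
Context (p_distr : is_distr p) (q_distr : is_distr q).
Context (pq_neq0 : forall i : 'I_k, ~ (p i 0 = 0 /\ q i 0 = 0)).
Context (T : 'M[R]_(l, k)) (T_LDP : LDP_channels eps l k T).
Context (T_extreme :
  extreme_point (LDP_output_pairs eps l p q) (T *m p, T *m q)).

Local Notation e := (expR eps).

Let p_ge0 : forall i, 0 <= p i 0 := p_distr.1.
Let q_ge0 : forall i, 0 <= q i 0 := q_distr.1.

Let T_ge0 y x : 0 <= T y x.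
Proof. by have /LDP_channelsP[] := T_LDP. Qed.

Let T_sum x : \sum_y T y x = 1.
Proof. by have /LDP_channelsP[] := T_LDP. Qed.

Let T_le y x x' : T y x <= e * T y x'.
Proof. by have /LDP_channelsP[] := T_LDP. Qed.

Definition tight (y : 'I_l) (u v : 'I_k) : bool := T y u == e * T y v.

(** The cone of feasible directions at [T]: only constraints active at [T] restrict [E]. *)
Definition tangent (E : 'M[R]_(l, k)) : Prop :=
  [/\ forall x, \sum_y E y x = 0,
      forall y u v, tight y u v -> E y u <= e * E y v &
      forall y x, T y x = 0 -> 0 <= E y x].

Lemma tangent_step (E : 'M[R]_(l, k)) : tangent E ->
  exists2 d, 0 < d & LDP_channels eps l k (T + d *: E).
Proof.
case=> E_sum E_tight E0.
pose I := ('I_l * 'I_k * 'I_k + 'I_l * 'I_k)%type.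
pose a (i : I) := match i with
  | inl (y, u, v) => e * T y v - T y u | inr (y, x) => T y x end.
pose b (i : I) := match i with
  | inl (y, u, v) => e * E y v - E y u | inr (y, x) => E y x end.
have [|[[[y u] v]|[y x]]|d d0 dP] := @small_step_ge0 _ I a b.
- by case=> [[[y u] v]|[y x]] /=; rewrite ?subr_ge0.
- by move/eqP; rewrite subr_eq0 eq_sym => /E_tight; rewrite subr_ge0.
- exact: E0.
exists d => //; apply/LDP_channelsP; split=> [y x|x|y u v].
- by have := dP (inr (y, x)); rewrite !mxE.
- under eq_bigr do rewrite !mxE.
  by rewrite big_split /= T_sum -mulr_sumr E_sum mulr0 addr0.
- have := dP (inl (y, u, v)); rewrite !mxE /=; nra.
Qed.

Lemma output_pair_extreme (Y Z : 'M[R]_(l, k)) (t : R) :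
    LDP_channels eps l k Y -> LDP_channels eps l k Z -> 0 < t < 1 ->
    T *m p = t *: (Y *m p) + (1 - t) *: (Z *m p) ->
    T *m q = t *: (Y *m q) + (1 - t) *: (Z *m q) ->
  Y *m p = T *m p /\ Y *m q = T *m q.
Proof.
move=> Y_LDP Z_LDP t01 eqp eqq.
have [_ /(_ (Y *m p, Y *m q) (Z *m p, Z *m q) t)] := T_extreme.
case=> //; [by exists Y | by exists Z | by rewrite eqp eqq | by case=> -> ->].
Qed.

(* [T] is a convex combination of points on the rays along [E1] and [E2]. *)
Lemma tangent_pair_ker (E1 E2 : 'M[R]_(l, k)) : tangent E1 -> tangent E2 ->
  (E1 + E2) *m p = 0 -> (E1 + E2) *m q = 0 -> E1 *m p = 0 /\ E1 *m q = 0.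
Proof.
move=> /tangent_step[a a0 aP] /tangent_step[b b0 bP] Ep Eq.
(* This weight gives [t * a = (1 - t) * b], so the two displacements cancel. *)
pose t := b / (a + b).
have ab0 : 0 < a + b by rewrite addr_gt0.
have ab_neq0 : a + b != 0 by rewrite gt_eqF.
have t01 : 0 < t < 1.
  by rewrite divr_gt0 // ltr_pdivrMr // mul1r ltrDr.
have comb (r : 'cV[R]_k) : (E1 + E2) *m r = 0 ->
    T *m r = t *: ((T + a *: E1) *m r) + (1 - t) *: ((T + b *: E2) *m r).
  rewrite mulmxDl => /eqP; rewrite addr_eq0 => /eqP Er.
  have ta : t * a = (1 - t) * b by rewrite /t; field.
  rewrite !mulmxDl -!scalemxAl Er !scalerDr addrACA -scalerDl !scalerA -ta.
  rewrite scalerN addNr addr0 addrC subrK.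
  by rewrite scale1r.
have [hp hq] := output_pair_extreme aP bP t01 (comb _ Ep) (comb _ Eq).
have ker (r : 'cV[R]_k) : (T + a *: E1) *m r = T *m r -> E1 *m r = 0.
  move/eqP; rewrite mulmxDl -subr_eq0 addrAC subrr add0r -scalemxAl.
  by rewrite scaler_eq0 gt_eqF //= => /eqP.
by split; apply: ker.
Qed.

(** The lineality space of the tangent cone. *)
Definition neutral (E : 'M[R]_(l, k)) : Prop :=
  [/\ forall x, \sum_y E y x = 0,
      forall y u v, tight y u v -> E y u = e * E y v &
      forall y x, T y x = 0 -> E y x = 0].

Lemma neutral_ker (E : 'M[R]_(l, k)) : neutral E ->
  E *m p = 0 /\ E *m q = 0.
Proof.
case=> E_sum E_tight E0.
apply: (@tangent_pair_ker E (- E)); rewrite ?subrr ?mul0mx //.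
  split=> // [y u v /E_tight -> //|y x /E0 -> //].
split=> [x|y u v /E_tight|y x /E0 eq0]; last by rewrite mxE eq0 oppr0.
  by under eq_bigr do rewrite mxE; rewrite sumrN E_sum oppr0.
by rewrite !mxE mulrN => ->.
Qed.

(** * Free entries and the absence of neutral directions *)

Definition free (y : 'I_l) (x : 'I_k) : bool :=
  [forall x', ~~ tight y x x' && ~~ tight y x' x].

(** A zero entry is tight with itself, the case [x' = x] of [free]. *)
Lemma free_neq0 y x : free y x -> T y x != 0.
Proof.
move/forallP/(_ x)/andP => [+ _]; apply: contra => /eqP T0.
by rewrite /tight T0 mulr0.
Qed.

Lemma row_eq0 y x : T y x = 0 -> forall x', T y x' = 0.
Proof.
move=> T0 x'; apply/eqP; rewrite eq_le T_ge0 andbT.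
by rewrite (le_trans (T_le y x' x)) // T0 mulr0.
Qed.

Definition exchange (y y' : 'I_l) (c : 'I_k -> R) : 'M[R]_(l, k) :=
  \matrix_(i, x) (((i == y)%:R - (i == y')%:R) * c x).

Lemma exchange_sum y y' c x : \sum_i exchange y y' c i x = 0.
Proof.
under eq_bigr do rewrite mxE mulrBl.
by rewrite sumrB !(sumr_indicator _ (fun=> c x)) subrr.
Qed.

Lemma exchange_ker y y' c (r : 'cV[R]_k) : y != y' ->
  exchange y y' c *m r = 0 -> \sum_x c x * r x 0 = 0.
Proof.
move=> /negPf yy' /matrixP/(_ y 0); rewrite !mxE => Er; rewrite -[RHS]Er.
by apply: eq_bigr => x _; rewrite mxE eqxx yy' subr0 mul1r.
Qed.

Lemma exchangeD y y' c c' :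
  exchange y y' c + exchange y y' c' = exchange y y' (fun x => c x + c' x).
Proof. by apply/matrixP => i x; rewrite !mxE mulrDr. Qed.

Lemma exchange_mul_eq0 y y' c (r : 'cV[R]_k) :
  \sum_x c x * r x 0 = 0 -> exchange y y' c *m r = 0.
Proof.
move=> c0; apply/matrixP => i j; rewrite !mxE (ord1 j).
under eq_bigr do rewrite mxE -mulrA.
by rewrite -mulr_sumr c0 mulr0.
Qed.

Lemma free_neutral (E : 'M[R]_(l, k)) : (forall x, \sum_y E y x = 0) ->
  (forall y x, ~~ free y x -> E y x = 0) -> neutral E.
Proof.
move=> E_sum E0; split=> // [y u v yuv|y x T0].
  rewrite !E0 ?mulr0 //; apply/negP.
    by move/forallP/(_ u); rewrite yuv andbF.
  by move/forallP/(_ v); rewrite yuv.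
by apply: E0; apply: contraL (introT eqP T0) => /free_neq0.
Qed.

Lemma free_uniq y y' x : free y x -> free y' x -> y = y'.
Proof.
move=> fy fy'; apply: contrapT => /eqP yy'.
pose c x' : R := (x' == x)%:R.
have [] := @neutral_ker (exchange y y' c).
  apply: free_neutral; first exact: exchange_sum.
  move=> i x' nf; rewrite mxE /c; have [x'x|] := eqVneq x' x; last first.
    by rewrite mulr0.
  have [iy|_] := eqVneq i y; first by rewrite x'x iy fy in nf.
  have [iy|_] := eqVneq i y'; first by rewrite x'x iy fy' in nf.
  by rewrite subrr mul0r.
move=> /(exchange_ker yy') + /(exchange_ker yy').
by rewrite !(sumr_indicator _ (fun x => _ x 0)) => px qx; apply: (@pq_neq0 x).
Qed.

(** In a tight pair the first entry is the row maximum and the second the row minimum. So a non-free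
    entry is one of the two, and every maximum is tight with every minimum, which fixes the ratios
    of [E]. The four cases are the choices of extremum at [x] and [x']. *)
Lemma nonfree_prop (E : 'M[R]_(l, k)) y x x' : neutral E ->
  ~~ free y x -> ~~ free y x' -> E y x * T y x' = E y x' * T y x.
Proof.
case=> _ E_tight _.
have sat u : ~~ free y u -> exists w, tight y u w \/ tight y w u.
  rewrite negb_forall => /existsP[w]; rewrite negb_and !negbK.
  by case/orP; exists w; [left | right].
have e0 : 0 < e := expR_gt0 eps.
have scale u w : tight y u w -> E y u * T y w = E y w * T y u.
  by move=> t; rewrite (E_tight _ _ _ t) (eqP t); ring.
have same u v : T y u = T y v -> E y u = E y v -> E y u * T y v = E y v * T y u.
  by move=> -> ->.
move=> /sat[w [xw|wx]] /sat[w' [xw'|wx']].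
- have eqT : T y x = T y x'.
    by apply/le_anti; rewrite {1}(eqP xw') {2}(eqP xw) !T_le.
  apply: same => //; rewrite (E_tight _ _ _ xw); apply/esym/E_tight.
  by rewrite /tight -eqT.
- apply: scale; rewrite /tight eq_le T_le /= -(eqP wx') (eqP xw).
  exact: T_le.
- apply/esym; apply: scale; rewrite /tight eq_le T_le /= -(eqP wx) (eqP xw').
  exact: T_le.
- have eqT : T y x = T y x'.
    apply: (mulfI (lt0r_neq0 e0)); apply/le_anti.
    by rewrite -{1}(eqP wx) T_le /= -(eqP wx') T_le.
  apply: same => //; apply: (mulfI (lt0r_neq0 e0)).
  rewrite -(E_tight _ _ _ wx); apply: E_tight.
  by rewrite /tight -eqT.
Qed.

Lemma neutral_nonfree_eq0 (E : 'M[R]_(l, k)) : neutral E ->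
  (forall y x, ~~ free y x -> E y x = 0) -> E = 0.
Proof.
case=> E_sum _ _ E0; apply/matrixP => y x; rewrite mxE.
have [fyx|/E0 //] := boolP (free y x).
rewrite -(E_sum x) (bigD1 y) //= big1 ?addr0 // => y' /eqP y'y.
by apply: E0; apply/negP => /free_uniq/(_ fyx).
Qed.

(* Along a neutral direction a row moves only by rescaling its non-free
   entries. Since [E *m r = 0], in each row the free part of [|E|] weighs at
   least as much as the non-free part; since columns sum to zero and have at
   most one free entry, in each column it weighs at most as much. *)
Lemma nonfree_column_neutral_eq0 (E : 'M[R]_(l, k)) (r : 'cV[R]_k) x0 :
    neutral E -> E *m r = 0 -> (forall x, 0 <= r x 0) -> r x0 0 != 0 ->
  (forall y, ~~ free y x0) -> E = 0.
Proof.
move=> neutE Er r0 rx0 nf0; have [E_sum _ E0] := neutE.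
(* The scaling factor of row [y]. If [T y x0] is zero, row [y] vanishes in both [T] and [E], so
   division by zero is harmless. *)
pose c y := E y x0 / T y x0.
have nfE y x : ~~ free y x -> E y x = c y * T y x.
  move=> nf; have [T0|T_neq0] := eqVneq (T y x0) 0.
    by rewrite E0 ?(row_eq0 T0) ?mulr0.
  by rewrite /c mulrAC (nonfree_prop neutE (nf0 y) nf) mulfK.
have row y : \sum_(x | ~~ free y x) `|E y x| * r x 0 <=
             \sum_(x | free y x) `|E y x| * r x 0.
  have -> : \sum_(x | ~~ free y x) `|E y x| * r x 0 =
            `|\sum_(x | ~~ free y x) E y x * r x 0|.
    have eqc : \sum_(x | ~~ free y x) E y x * r x 0 =
               c y * \sum_(x | ~~ free y x) T y x * r x 0.
      by rewrite mulr_sumr; apply: eq_bigr => x nf; rewrite nfE // mulrA.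
    rewrite eqc normrM [X in _ * X]ger0_norm; last first.
      by apply: sumr_ge0 => x _; rewrite mulr_ge0.
    rewrite mulr_sumr; apply: eq_bigr => x nf.
    by rewrite nfE // normrM (ger0_norm (T_ge0 _ _)) mulrA.
  have /eqP : \sum_x E y x * r x 0 = 0.
    by move/matrixP/(_ y 0): Er; rewrite !mxE.
  rewrite (bigID (free y)) /= addrC addr_eq0 => /eqP ->; rewrite normrN.
  apply: le_trans (ler_norm_sum _ _ _) _; apply: ler_sum => x _.
  by rewrite normrM (ger0_norm (r0 x)).
pose G x := \sum_(y | ~~ free y x) `|E y x| - \sum_(y | free y x) `|E y x|.
have G0 x : 0 <= G x.
  rewrite subr_ge0.
  have [y fy|nf] := pickP (fun y => free y x); last first.
    by rewrite big_pred0 // sumr_ge0.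
  have fE y' : free y' x = (y' == y).
    by apply/idP/eqP => [/free_uniq/(_ fy)|->].
  rewrite (big_pred1 y) //.
  have /eqP : \sum_y E y x = 0 by [].
  rewrite (bigD1 y) //= addr_eq0 => /eqP ->; rewrite normrN.
  under [leRHS]eq_bigl do rewrite fE.
  exact: ler_norm_sum.
have Gr : \sum_x G x * r x 0 <= 0.
  under eq_bigr do rewrite mulrBl !mulr_suml.
  rewrite sumrB subr_le0 [leLHS](exchange_big_dep xpredT) //=.
  rewrite [leRHS](exchange_big_dep xpredT) //=.
  exact: ler_sum.
(* Nonnegative terms with nonpositive sum all vanish. Column [x0] has no free entry, so [G x0] is
   its whole l1 norm and every [c y] is zero. *)
have /eqP : G x0 * r x0 0 = 0.
  have nonneg x : true -> 0 <= G x * r x 0 by rewrite mulr_ge0.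
  apply: (psumr_eq0P (P := xpredT) nonneg) => //.
  by apply/le_anti; rewrite Gr sumr_ge0.
rewrite mulf_eq0 (negPf rx0) orbF.
rewrite /G [X in _ - X]big_pred0 ?subr0; last by move=> y; apply: negbTE.
rewrite psumr_eq0 // => /allP Ex0.
apply: (neutral_nonfree_eq0 neutE) => y x /nfE ->; rewrite /c.
have /implyP/(_ (nf0 y)) := Ex0 y (mem_index_enum _).
by rewrite normr_eq0 => /eqP ->; rewrite !mul0r.
Qed.

(* The perturbation rescales row [y] and compensates in the free entries. *)
Lemma free_columns_support :
  (forall x, exists y, free y x) -> forall y x, ~~ free y x -> T y x = 0.
Proof.
move=> /fin_all_exists[f f_free] y x nf; apply: contrapT => T_neq0.
pose E : 'M[R]_(l, k) :=
  \matrix_(i, x') (((i == y)%:R - (i == f x')%:R) * T y x').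
have E_neutral : neutral E.
  split=> [x'|i u v iuv|i x' T0].
  - under eq_bigr do rewrite mxE mulrBl.
    by rewrite sumrB !(sumr_indicator _ (fun=> T y x')) subrr.
  - rewrite !mxE.
    have [iu|_] := eqVneq i (f u).
      by have /forallP/(_ v) := f_free u; rewrite -iu iuv.
    have [iv|_] := eqVneq i (f v).
      by have /forallP/(_ u) := f_free v; rewrite -iv iuv andbF.
    have [eiy|_] := eqVneq i y; last by rewrite subrr !mul0r mulr0.
    by rewrite subr0 !mul1r -eiy (eqP iuv).
  - rewrite mxE; have [iy|_] := eqVneq i y; first by rewrite -iy T0 mulr0.
    have [ix|_] := eqVneq i (f x'); last by rewrite subrr mul0r.
    by have := free_neq0 (f_free x'); rewrite -ix T0 eqxx.
(* Row [y] of [E] has no negative entry and is positive at [x], so a nonnegative [r] that it kills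
   vanishes at [x]. *)
have ker (r : 'cV[R]_k) : (forall x, 0 <= r x 0) -> E *m r = 0 -> r x 0 = 0.
  move=> r0 /matrixP/(_ y 0); rewrite !mxE.
  have nonneg x' : true -> 0 <= E y x' * r x' 0.
    by move=> _; rewrite mxE eqxx mulr_ge0 // mulr_ge0 // subr_ge0 lern1 leq_b1.
  move/(psumr_eq0P nonneg)/(_ x isT)/eqP; rewrite mxE eqxx.
  have [yf|_] := eqVneq y (f x); first by rewrite yf f_free in nf.
  by rewrite subr0 mul1r mulf_eq0 (introF eqP T_neq0) => /eqP.
have [Ep Eq] := neutral_ker E_neutral.
by apply: (@pq_neq0 x); split; apply: ker.
Qed.

(** If every column has a free entry, [T] and hence [E] vanish off the free entries. Otherwise the
    counting argument applies with whichever of [p], [q] is nonzero at a column without free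
    entry. *)
Lemma neutral_eq0 (E : 'M[R]_(l, k)) : neutral E -> E = 0.
Proof.
move=> neutE; have [Ep Eq] := neutral_ker neutE.
have [/forallP f_all|] := boolP [forall x, [exists y, free y x]].
  apply: (neutral_nonfree_eq0 neutE) => y x nf; have [_ _ E0] := neutE.
  by apply/E0/free_columns_support => // x'; apply/existsP.
rewrite negb_forall => /existsP[x]; rewrite negb_exists => /forallP nf.
have [px|px] := eqVneq (p x 0) 0; last first.
  exact: (nonfree_column_neutral_eq0 neutE Ep p_ge0 px nf).
apply: (nonfree_column_neutral_eq0 neutE Eq q_ge0 _ nf).
by apply/eqP => qx; apply: (@pq_neq0 x).
Qed.

(** A constraint active at a proper mixture is active at both terms, so [Y - T] is neutral. *)
Lemma extreme_output_pair_channel : extreme_point (LDP_channels eps l k) T.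
Proof.
split=> // Y Z t /LDP_channelsP[Y0 Y1 Yle] /LDP_channelsP[Z0 Z1 Zle].
move=> /andP[t0 t1] eqT.
have t1' : 0 < 1 - t by rewrite subr_gt0.
have TE y x : T y x = t * Y y x + (1 - t) * Z y x by rewrite eqT !mxE.
have YT : Y = T.
  apply/eqP; rewrite -subr_eq0; apply/eqP/neutral_eq0; split.
  - by move=> x; under eq_bigr do rewrite !mxE; rewrite sumrB Y1 T_sum subrr.
  - move=> y u v /eqP yuv; rewrite !mxE mulrBr -yuv; congr (_ - _).
    apply/le_anti; rewrite Yle /=; rewrite !TE in yuv.
    have := Zle y u v; rewrite -(ler_pM2l t1') => leZ.
    rewrite -(ler_pM2l t0); lra.
  - move=> y x T0; rewrite !mxE T0 subr0; apply/le_anti; rewrite Y0 andbT.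
    rewrite -(ler_pM2l t0) mulr0 -T0 TE lerDl.
    by rewrite (mulr_ge0 (ltW t1')) ?Z0.
split=> //; apply/matrixP => y x; move: (TE y x); rewrite YT => eqyx.
by apply: (mulfI (lt0r_neq0 t1')); lra.
Qed.

(** * Exchanges at inputs ordered by likelihood ratio *)

Definition exchangeable (y y' : 'I_l) (x : 'I_k) : bool :=
  [exists w, T y x < T y w] && [exists w, T y' w < T y' x].

(** If [tight i u v], then [u] is at the row maximum and [v] at the minimum, so [d u <= 0 <= d v]. A
    zero entry is also a minimum. *)
Lemma row_tangent (i : 'I_l) (d : 'I_k -> R) :
    (forall x, 0 < d x -> [exists w, T i x < T i w]) ->
    (forall x, d x < 0 -> [exists w, T i w < T i x]) ->
  (forall u v, tight i u v -> d u <= e * d v) /\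
  (forall x, T i x = 0 -> 0 <= d x).
Proof.
move=> dpos dneg; split=> [u v /eqP iuv|x T0]; last first.
  rewrite leNgt; apply/negP => /dneg/existsP[w].
  by rewrite T0 ltNge T_ge0.
have e0 : 0 < e := expR_gt0 eps.
apply: (@le_trans _ _ 0).
  rewrite leNgt; apply/negP => /dpos/existsP[w].
  by rewrite iuv ltNge T_le.
rewrite pmulr_rge0 // leNgt; apply/negP => /dneg/existsP[w].
by rewrite -(ltr_pM2l e0) -iuv ltNge T_le.
Qed.

Lemma exchange_tangent y y' (c : 'I_k -> R) : y != y' ->
    (forall x, 0 < c x -> exchangeable y y' x) ->
    (forall x, c x < 0 -> exchangeable y' y x) ->
  tangent (exchange y y' c).
Proof.
move=> yy' cpos cneg.
have [] := @row_tangent y c.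
- by move=> x /cpos/andP[].
- by move=> x /cneg/andP[].
move=> yt y0; have [] := @row_tangent y' (fun x => - c x).
- by move=> x; rewrite oppr_gt0 => /cneg/andP[].
- by move=> x; rewrite oppr_lt0 => /cpos/andP[].
move=> y't y'0; split=> [x|i u v|i x]; first exact: exchange_sum.
  rewrite !mxE; have [->|iy] := eqVneq i y.
    by rewrite (negPf yy') subr0 !mul1r; apply: yt.
  have [->|iy'] := eqVneq i y'; last by rewrite subrr !mul0r mulr0.
  by rewrite sub0r !mulN1r; apply: y't.
rewrite !mxE; have [->|iy] := eqVneq i y.
  by rewrite (negPf yy') subr0 mul1r; apply: y0.
have [->|iy'] := eqVneq i y'; last by rewrite subrr !mul0r.
by rewrite sub0r mulN1r; apply: y'0.
Qed.

(* The vector [(p v, q v)] lies in the cone spanned by those of [u] and [w], so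
   the effect on the output pair of moving mass between [y] and [y'] at [v] is
   cancelled by moving it back at [u] and [w]. The directions below move back
   only ([c1]), or move back and move twice the mass at [v] ([c2]). *)
Lemma exchangeable_between y y' u v w : y != y' ->
    (likelihood_ratio p q u <= likelihood_ratio p q v)%E ->
    (likelihood_ratio p q v <= likelihood_ratio p q w)%E ->
  exchangeable y' y u -> exchangeable y y' v -> exchangeable y' y w -> False.
Proof.
move=> yy' uv vw exu exv exw.
have [d [a [b [d0 a0 b0 dp dq]]]] :=
  likelihood_ratio_between p_ge0 q_ge0 pq_neq0 uv vw.
pose c1 x : R := - (a * (x == u)%:R + b * (x == w)%:R).
pose c2 x : R := c1 x + (d + d) * (x == v)%:R.
have c1_le0 x : c1 x <= 0.
  by rewrite oppr_le0 addr_ge0 // mulr_ge0.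
have neg x : c1 x < 0 -> exchangeable y' y x.
  rewrite /c1; have [-> //|_] := eqVneq x u; have [-> //|_] := eqVneq x w.
  by rewrite !mulr0 addr0 oppr0 ltxx.
have sum1 (r : 'cV[R]_k) :
    \sum_x c1 x * r x 0 = - (a * r u 0 + b * r w 0).
  under eq_bigr do rewrite mulNr mulrDl -!mulrA.
  by rewrite sumrN big_split /= -!mulr_sumr !(sumr_indicator _ (fun x => r x 0)).
have sum2 (r : 'cV[R]_k) : d * r v 0 = a * r u 0 + b * r w 0 ->
    (exchange y y' c1 + exchange y y' c2) *m r = 0.
  move=> dr; rewrite exchangeD; apply: exchange_mul_eq0.
  under eq_bigr do rewrite addrA mulrDl mulrDl -mulrA.
  rewrite big_split big_split /= -mulr_sumr (sumr_indicator _ (fun x => r x 0)).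
  by rewrite sum1 -dr; ring.
have [||||] := @tangent_pair_ker (exchange y y' c1) (exchange y y' c2).
- by apply: exchange_tangent => // x; rewrite ltNge c1_le0.
(* [c2] is positive at most at [v] and negative only where [c1] is, even if [v] coincides with [u]
   or [w]. *)
- apply: exchange_tangent => // x; rewrite /c2.
    have [-> //|_] := eqVneq x v.
    by rewrite mulr0 addr0 ltNge c1_le0.
  move=> c2x; apply: neg; apply: le_lt_trans c2x.
  by rewrite lerDl mulr_ge0 // addr_ge0 // ltW.
- exact: sum2.
- exact: sum2.
move=> /(exchange_ker yy') + /(exchange_ker yy'); rewrite !sum1 -dp -dq.
move=> /eqP + /eqP; rewrite !oppr_eq0 !mulf_eq0 (gt_eqF d0) /=.
by move=> /eqP pv /eqP qv; apply: (@pq_neq0 v).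
Qed.

(** Both columns sum to one, so a gain in one row forces a loss in another. *)
Lemma columns_differ (x x' : 'I_k) : (exists y, T y x != T y x') ->
  exists y y', [/\ y != y', T y x < T y x' & T y' x' < T y' x].
Proof.
have lt_ex u v : (exists y, T y u != T y v) -> exists y, T y u < T y v.
  case=> y0 neq; apply/existsP; apply: contraT; rewrite negb_exists => /forallP ge.
  have nonneg y : true -> 0 <= T y u - T y v.
    by move=> _; rewrite subr_ge0 leNgt ge.
  have sum0 : \sum_y (T y u - T y v) = 0 by rewrite sumrB !T_sum subrr.
  have /eqP : T y0 u - T y0 v = 0 := psumr_eq0P nonneg sum0 isT.
  by rewrite subr_eq0 (negPf neq).
move=> neq; have [y lty] := lt_ex _ _ neq.
have [|y' lty'] := lt_ex x' x; first by case: neq => i; rewrite eq_sym; exists i.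
exists y, y'; split=> //; apply: contraTneq lty => ->.
by rewrite -leNgt ltW.
Qed.

(** * The level of an input *)

Definition crossed (x : 'I_k) : {pred 'I_l * 'I_l} :=
  [pred yy' | [exists v,
    (likelihood_ratio p q v <= likelihood_ratio p q x)%E &&
    exchangeable yy'.2 yy'.1 v]].

Definition level (x : 'I_k) : nat := #|crossed x|.

Lemma crossed_sub (u v : 'I_k) :
  (likelihood_ratio p q u <= likelihood_ratio p q v)%E ->
  crossed u \subset crossed v.
Proof.
move=> uv; apply/fintype.subsetP => yy'; rewrite !inE => /existsP[w /andP[wu exw]].
by apply/existsP; exists w; rewrite (le_trans wu uv).
Qed.

Lemma level_le (u v : 'I_k) :
  (likelihood_ratio p q u <= likelihood_ratio p q v)%E ->
  (level u <= level v)%N.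
Proof. by move/crossed_sub/subset_leq_card. Qed.

(** Nested [crossed] sets of equal size coincide. If the columns differed, a pair crossed at [v]
    because of [v] itself would be crossed at [u] because of some [w], and the exchanges at [w],
    [u], [v] would alternate. *)
Lemma level_column (u v : 'I_k) : level u = level v ->
  forall y, T y u = T y v.
Proof.
wlog uv : u v / (likelihood_ratio p q u <= likelihood_ratio p q v)%E.
  move=> wl; have [uv|/ltW vu] :=
    leP (likelihood_ratio p q u) (likelihood_ratio p q v); first exact: wl.
  by move/esym => lev y; rewrite (wl v u).
move=> lev y0; apply: contrapT => /eqP neq.
have [|y [y' [yy' lty lty']]] := @columns_differ u v; first by exists y0.
have exv : exchangeable y' y v.
  by apply/andP; split; apply/existsP; exists u.
have exu : exchangeable y y' u.
  by apply/andP; split; apply/existsP; exists v.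
have : (y, y') \in crossed u.
  rewrite (subset_cardP lev (crossed_sub uv)).
  by apply/existsP; exists v; rewrite lexx.
by move=> /existsP[w /andP[wu exw]]; apply: (exchangeable_between yy' wu uv exw).
Qed.

Lemma level_lt (x : 'I_k) : (level x < 2 * l ^ 2)%N.
Proof.
(* Strictness needs a nonempty output set: a column of [T] sums to one. *)
have l_gt0 : (0 < l)%N.
  case: (posnP l) => // l0; have := T_sum x; rewrite big1 => [/eqP|i].
    by rewrite eq_sym oner_eq0.
  by have := ltn_ord i; rewrite [X in (_ < X)%N]l0.
apply: (leq_ltn_trans (max_card _)).
rewrite card_prod card_ord -mulnn mul2n -addnn -[ltnLHS]addn0 ltn_add2l.
by rewrite muln_gt0 l_gt0.
Qed.

End ExtremeOutputPairs.

(* A column of the expanded channel not in the range of [f] is reached by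
   rerouting through it one input of the same column. *)
Lemma expand_extreme_channel (R : realType) (eps : R) (l k n : nat)
    (T : 'M[R]_(l, k)) (f : 'I_k -> 'I_n) (g : 'I_n -> 'I_k) :
  extreme_point (LDP_channels eps l k) T ->
  (forall x y, T y (g (f x)) = T y x) ->
  extreme_point (LDP_channels eps l n) (\matrix_(y, j) T y (g j)).
Proof.
have pull m m' (h : 'I_m -> 'I_m') (S : 'M[R]_(l, m')) :
    LDP_channels eps l m' S -> LDP_channels eps l m (\matrix_(y, x) S y (h x)).
  move=> /LDP_channelsP[S0 S1 Sle]; apply/LDP_channelsP.
  split=> [y x|x|y x x']; rewrite ?mxE //.
  by under eq_bigr do rewrite mxE; apply: S1.
move=> [T_LDP T_ext] gf; split=> [|Y Z t Y_LDP Z_LDP t01 eqYZ]; first exact: pull.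
pose h j x := if x == g j then j else f x.
have {}T_ext j :
    \matrix_(y, x) Y y (h j x) = T /\ \matrix_(y, x) Z y (h j x) = T.
  apply: (T_ext _ _ t) => //; try exact: pull.
  apply/matrixP => y x; move/matrixP/(_ y (h j x)): eqYZ; rewrite !mxE => <-.
  by rewrite /h; case: eqP => [->|_]; rewrite ?gf.
split; apply/matrixP => y j; rewrite mxE.
  by have [/matrixP/(_ y (g j)) + _] := T_ext j; rewrite mxE /h eqxx.
by have [_ /matrixP/(_ y (g j))] := T_ext j; rewrite mxE /h eqxx.
Qed.

Theorem theorem1p17 (R : realType) (k l : nat) (p q : 'cV[R]_k) (eps : R)
    (p_distr : is_distr p) (q_distr : is_distr q)
    (pq_neq0 : forall i : 'I_k, ~ (p i 0 = 0 /\ q i 0 = 0))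
    (eps_ge0 : 0 <= eps) (T : 'M[R]_(l, k)) (T_LDP : LDP_channels eps l k T)
    (T_extreme :
      extreme_point (LDP_output_pairs eps l p q) (T *m p, T *m q)) :
  exists (T1 : 'M[R]_((2 * l ^ 2)%N, k)) (T2 : 'M[R]_(l, (2 * l ^ 2)%N)),
    [/\ threshold_channel p q T1,
        extreme_point (LDP_channels eps l (2 * l ^ 2)%N) T2 &
        T = T2 *m T1].
Proof.
have [x0 _ _] : exists2 x : 'I_k, true & p x 0 != 0.
  apply/exists_inP; rewrite -negb_forall_in; apply/negP => /forall_inP p0.
  have := p_distr.2; rewrite big1 => [/eqP|x _]; last by apply/eqP/p0.
  by rewrite eq_sym oner_eq0.
pose f x := Ordinal (level_lt p q T_LDP x).
(* A representative input for each level; [x0] is an arbitrary default for levels not attained. *)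
pose g (j : 'I_(2 * l ^ 2)) := odflt x0 [pick x | f x == j].
have gf x y : T y (g (f x)) = T y x.
  rewrite /g; case: pickP => [x' /eqP[lev]|/(_ x)]; last by rewrite eqxx.
  exact: (level_column p_distr q_distr pq_neq0 T_LDP T_extreme lev).
exists (det_channel R f), (\matrix_(y, j) T y (g j)); split.
- exists f; split=> // u v uv fuv w uw wv.
  suff -> : f w = f u by rewrite -fuv.
  apply/val_inj/eqP; rewrite eqn_leq {1}fuv /=.
  by apply/andP; split; apply/level_le/ltW.
- apply: expand_extreme_channel gf.
  exact: (extreme_output_pair_channel p_distr q_distr pq_neq0 T_LDP T_extreme).
- apply/matrixP => y x; rewrite !mxE.
  under eq_bigr do rewrite !mxE mulrC.
  by rewrite (sumr_indicator _ (fun j => T y (g j))) gf.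
Qed.
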